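(* Let $k$ be a field, $G$ a (totally) ordered abelian group, and let $s=\sum_{g\in G}s_gt^g\in k((G))$. Then $s\in k(G)$ if and only if the following holds: there exist $\ell\in\mathbb{N}$, a finite set $A=\{g_0,\ldots,g_\ell\}\subseteq G$ with $g_0<\ldots<g_\ell$, and elements $r_0,\ldots,r_\ell\in k$, not all equal to $0$, such that for any $h\in G\setminus A$ $$\sum_{j=0}^\ell r_js_{h-g_j}=0.$$
   Context: $\mathbb{N}$ includes $0$. $k((G))$ denotes the field of generalised power series: all functions $s\colon G\to k$, written $s=\sum_{g\in G}s_gt^g$, whose support $\{g\in G\mid s_g\neq 0\}$ is a well-ordered subset of $G$, with pointwise addition and product $sp=\sum_{g}\left(\sum_{h}s_hp_{g-h}\right)t^g$. The group ring $k[G]$ is the subring of all $s\in k((G))$ with finite support, and $k(G)$ is the fraction field of $k[G]$ inside $k((G))$. *)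

(* Defs.v *)
From HB Require Import structures.
From mathcomp Require Import all_boot all_order all_algebra.
From mathcomp Require Import all_classical.
From mathcomp Require Import wochoice.

Set Implicit Arguments.
Unset Strict Implicit.
Unset Printing Implicit Defensive.

Import Order.TTheory GRing.Theory Num.Theory.
Local Open Scope classical_set_scope.
Local Open Scope ring_scope.

(* [porderZmodType] does not relate the order to the addition. *)
HB.mixin Record POrderedZmodule_isOrderedAbelianGroup G
    of Num.POrderedZmodule G := {
  oag_le_total : total (<=%R : rel G);
  oag_lerD2r : forall z x y : G, x <= y -> x + z <= y + z
}.

#[short(type="oagType")]
HB.structure Definition OrderedAbelianGroup :=
  { G of Num.POrderedZmodule G & POrderedZmodule_isOrderedAbelianGroup G }.

Section PowerSeries.
Variables (k : fieldType) (G : oagType).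

(* An element of k((G)); [coef s g] is the coefficient s_g of t^g. *)
Record power_series := PowerSeries {
  coef :> G -> k;
  coef_wo : wo_chain <=%R (support coef)
}.

Implicit Types s p q u : power_series.

Definition in_group_ring s := finite_set [set` support s].

Definition nonzero_series s := exists g, s g != 0.

Definition series_one : G -> k := fun g => (g == 0)%:R.

(* The coefficients of the product s * p. The sum over all h in G is a finitely
   supported one, because the supports of s and p are well-ordered. *)
Definition series_mul s p : G -> k :=
  fun g => \sum_(h \in [set: G]) s h * p (g - h).

(* s = p / q with p, q in k[G] and q != 0, where u is the inverse of q in
   k((G)). *)
Definition in_fraction_field s :=
  exists p q u,
    [/\ in_group_ring p, in_group_ring q, nonzero_series q,
        series_mul q u =1 series_one & s =1 series_mul p u].

End PowerSeries.

(* Main.v *)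
Require Import Defs.
From HB Require Import structures.
From mathcomp Require Import all_boot all_order all_algebra.
From mathcomp Require Import all_classical.
From mathcomp Require Import wochoice.

Set Implicit Arguments.
Unset Strict Implicit.
Unset Printing Implicit Defensive.

Import Order.TTheory GRing.Theory Num.Theory.
Local Open Scope ring_scope.

(** If [q s] has finite support for some nonzero [q] in k[G], then [s] is the
    quotient [(q s) / q]: writing [q = c t^a (1 - e)] with the support of [e]
    positive, the inverse of [q] is supported on [-a] plus the submonoid
    generated by the support of [e], and a finitely generated submonoid of the
    nonnegative cone is well-ordered.  The finite set A serves both as the set
    of exponents of [q] and as a bound on the support of [q s]. *)

(** * Order arithmetic in [G] *)

Section OrderedAbelianGroups.
Context {G : oagType}.
Implicit Types (x y z e : G) (A B X : set G) (L : seq G).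

Lemma oag_leD2r z x y : (x + z <= y + z) = (x <= y).
Proof.
apply/idP/idP; last exact: oag_lerD2r.
by move=> /(oag_lerD2r (- z)); rewrite !addrK.
Qed.

Lemma oag_ltD2r z x y : (x + z < y + z) = (x < y).
Proof. by rewrite !lt_neqAle oag_leD2r (inj_eq (addIr z)). Qed.

Lemma oag_leNgt x y : (x <= y) = ~~ (y < x).
Proof.
apply/idP/idP => [xy|]; first by apply/negP => /(le_lt_trans xy); rewrite ltxx.
have /orP[//|] := oag_le_total x y.
by rewrite le_eqVlt => /orP[/eqP->|->].
Qed.

Lemma oag_subr_gt0 x y : (0 < y - x) = (x < y).
Proof. by rewrite -[LHS](oag_ltD2r x) subrK add0r. Qed.

Lemma oag_ltrBl x e : 0 < e -> x - e < x.
Proof. by move=> e0; rewrite -oag_subr_gt0 opprB addrC subrK. Qed.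

Lemma oag_ler_pMn2r e m n : 0 < e -> (m <= n)%N -> e *+ m <= e *+ n.
Proof.
move=> e0 /subnK <-; elim: (n - m)%N => // d IH.
by apply: (le_trans IH); rewrite addSn mulrS -{1}[_ *+ _]add0r oag_leD2r ltW.
Qed.

Local Open Scope classical_set_scope.

(** * Well-ordered subsets of [G], up to submonoids generated by finitely many positive elements *)

Definition has_min X := exists2 x, X x & forall y, X y -> x <= y.

Definition well_ordered A := forall X, X `<=` A -> X !=set0 -> has_min X.

(** Either nothing in [X] lies below [z], and [z] is the minimum, or a minimum of the part below [z]
    is one of all of [X]. *)
Lemma has_min_below X z : X z ->
  ([set x | X x /\ x < z] !=set0 -> has_min [set x | X x /\ x < z]) ->
  has_min X.
Proof.
move=> Xz minX; pose X' := [set x | X x /\ x < z].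
have [X'0|/set0P/minX[x [Xx xz] xmin]] := eqVneq X' set0.
  exists z => // y Xy; rewrite oag_leNgt; apply/negP => yz.
  by suff : X' y by rewrite X'0.
exists x => // y Xy; rewrite oag_leNgt; apply/negP => yx.
suff /xmin : X' y by rewrite oag_leNgt yx.
by split=> //; exact: lt_trans xz.
Qed.

(** [wo_chain] asks for a unique minimum of boolean subsets; uniqueness comes from antisymmetry, and
    [asbool] passes from sets to boolean predicates. *)
Lemma wo_chainP (A : {pred G}) : wo_chain <=%R A <-> well_ordered [set` A].
Proof.
split=> [woA X XA [x Xx]|woA X XA [x Xx]].
  have [||z [[zX zmin] _]] := woA [pred y | `[< X y >]].
  - by move=> y /asboolP/XA.
  - by exists x; apply/asboolP.
  by exists z; [exact/asboolP|move=> y Xy; apply/zmin/asboolP].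
have [||z Xz zmin] := woA [set` X]; first by move=> y; exact: XA.
  by exists x.
exists z; split; first by split=> // y /zmin.
by move=> y [Xy ymin]; apply/le_anti; rewrite zmin// ymin.
Qed.

Lemma well_ordered_sub A B : well_ordered B -> A `<=` B -> well_ordered A.
Proof. by move=> woB AB X XA; apply: woB => x /XA /AB. Qed.

Lemma well_ordered_set0 : well_ordered set0.
Proof. by move=> X X0 [x /X0]. Qed.

Lemma well_ordered_set1 x : well_ordered [set x].
Proof. by move=> X Xx [y Xy]; exists y => // z /Xx ->; rewrite (Xx _ Xy). Qed.

#[global] Arguments well_ordered_set1 x : clear implicits.

Lemma well_orderedU A B :
  well_ordered A -> well_ordered B -> well_ordered (A `|` B).
Proof.
move=> woA woB X XAB X0.
have [XA|/set0P XA] := eqVneq (X `&` A) set0.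
  apply: woB X0 => x Xx; have [Ax|//] := XAB _ Xx.
  by suff : (X `&` A) x by rewrite XA.
have [XB|/set0P XB] := eqVneq (X `&` B) set0.
  apply: woA X0 => x Xx; have [//|Bx] := XAB _ Xx.
  by suff : (X `&` B) x by rewrite XB.
have [a [Xa _] amin] := woA _ (@subIsetr _ X A) XA.
have [b [Xb _] bmin] := woB _ (@subIsetr _ X B) XB.
have /orP[ab|ba] := oag_le_total a b.
- exists a => // y Xy; have [Ay|By] := XAB _ Xy; first exact: amin.
  exact: le_trans ab (bmin _ _).
- exists b => // y Xy; have [Ay|By] := XAB _ Xy; last exact: bmin.
  exact: le_trans ba (amin _ _).
Qed.

Lemma well_ordered_translate A z :
  well_ordered A -> well_ordered [set x | A (x - z)].
Proof.
move=> woA X XA [x Xx].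
have [|| y Xy ymin] := woA [set y | X (y + z)].
- by move=> y /XA /=; rewrite addrK.
- by exists (x - z); rewrite /= subrK.
exists (y + z) => // t Xt.
by rewrite -(oag_leD2r (- z)) addrK ymin//= subrK.
Qed.

#[global] Arguments well_ordered_translate {A} z _.

Lemma well_ordered_translates A L : well_ordered A ->
  well_ordered [set x | exists2 h, h \in L & A (x - h)].
Proof.
move=> woA; elim: L => [|z L IH].
  by apply: (well_ordered_sub well_ordered_set0) => x [].
apply: (well_ordered_sub (well_orderedU (well_ordered_translate z woA) IH)).
move=> x [h]; rewrite inE => /predU1P[->|hL] Ah; first by left.
by right; exists h.
Qed.

#[global] Arguments well_ordered_translates {A} L _.

Lemma well_ordered_seq L : well_ordered [set` L].
Proof.
apply: (well_ordered_sub (well_ordered_translates L (well_ordered_set1 0))).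
by move=> x xL; exists x; rewrite //= subrr.
Qed.

(** The set is A + Ne. Minimising the component in [A] first caps the number of copies of [e] that
    smaller elements of [X] can use; induction on that cap then finds the minimum. *)
Lemma well_ordered_addMn A e : 0 < e -> well_ordered A ->
  well_ordered [set x | exists n, A (x - e *+ n)].
Proof.
move=> e0 woA.
(* Induction on the cap: below the least a + (n-1)e in [X] with [a] in [A], or everywhere if there
   is none, elements of [X] use fewer than n-1 copies of [e]. *)
have bounded n : forall X, X !=set0 ->
    (forall x, X x -> exists2 m, (m < n)%N & A (x - e *+ m)) -> has_min X.
  elim: n => [|n IH] X X0 XA; first by have [x /XA[]] := X0.
  pose An := [set a | A a /\ X (a + e *+ n)].
  have [An0|/set0P An0] := eqVneq An set0.
    apply: IH => // x Xx; have [m] := XA _ Xx.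
    rewrite ltnS leq_eqVlt => /predU1P[->|mn] Am; last by exists m.
    suff : An (x - e *+ n) by rewrite An0.
    by split=> //; rewrite subrK.
  have [|a [Aa Xa] amin] := woA An _ An0; first by move=> a [].
  apply: (has_min_below Xa) => X'0; apply: IH => // x [Xx xa].
  have [m] := XA _ Xx.
  rewrite ltnS leq_eqVlt => /predU1P[->|mn] Am; last by exists m.
  suff : a <= x - e *+ n by rewrite -(oag_leD2r (e *+ n)) subrK oag_leNgt xa.
  by apply: amin; split=> //; rewrite subrK.
move=> X XA [x0 Xx0].
pose A' := [set a | A a /\ exists n, X (a + e *+ n)].
have [||a [Aa [n Xa]] amin] := woA A'; first by move=> a [].
  have [n An] := XA _ Xx0; exists (x0 - e *+ n); split=> //.
  by exists n; rewrite subrK.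
(* By minimality of [a], the elements of [X] below [a + n e] are of the form
   [b + m e] with [b] in [A] and [m < n]. *)
apply: (has_min_below Xa) => X'0; apply: (bounded n) => // x [Xx xa].
have [m Am] := XA _ Xx; exists m => //; rewrite ltnNge; apply/negP => nm.
have ax : a <= x - e *+ m by apply: amin; split=> //; exists m; rewrite subrK.
suff : a + e *+ n <= x by rewrite oag_leNgt xa.
rewrite -(oag_leD2r (e *+ m)) subrK in ax; apply: le_trans ax.
by rewrite ![a + _]addrC oag_leD2r oag_ler_pMn2r.
Qed.

(** Adjoining the generators one at a time makes each of them a single application of
    [well_ordered_addMn]. *)
Fixpoint submonoid_gen L : set G :=
  if L is e :: L' then [set x | exists n, submonoid_gen L' (x - e *+ n)]
  else [set 0].

Lemma well_ordered_submonoid_gen L :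
  {in L, forall e, 0 < e} -> well_ordered (submonoid_gen L).
Proof.
elim: L => [|e L IH] L0; first exact: well_ordered_set1.
apply: well_ordered_addMn; first by rewrite L0// mem_head.
by apply: IH => z zL; rewrite L0// inE zL orbT.
Qed.

Lemma submonoid_gen0 L : submonoid_gen L 0.
Proof. by elim: L => //= e L IH; exists 0%N; rewrite mulr0n subr0. Qed.

Lemma submonoid_genD L x e :
  e \in L -> submonoid_gen L x -> submonoid_gen L (x + e).
Proof.
elim: L x => //= z L IH x; rewrite inE => /predU1P[->|eL] [n Mx].
  by exists n.+1; rewrite mulrSr opprD addrACA subrr addr0.
by exists n; rewrite addrAC; exact: IH.
Qed.

End OrderedAbelianGroups.

(** * Finite convolutions and inverses of group ring elements *)

Section Series.
Variables (k : fieldType) (G : oagType).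
Implicit Types (f g w : G -> k) (s p q u : power_series k G) (L : seq G).
Implicit Types (x y z : G).

Local Open Scope classical_set_scope.

(* [w] is [b / (1 - sum_e a_e t^e)], obtained coefficient by coefficient instead
   of by summing the geometric series. *)
Lemma linear_recursion (M : set G) L (a b : G -> k) :
    well_ordered M -> {in L, forall e, 0 < e} ->
    (forall x e, e \in L -> M x -> M (x + e)) -> (forall x, b x != 0 -> M x) ->
  exists2 w : G -> k, forall x, w x != 0 -> M x &
    forall x, w x = b x + \sum_(e <- L) a e * w (x - e).
Proof.
move=> woM L0 MD bM.
(* Restricting [<] to [M] makes it well-founded; a point outside [M] has no [R]-predecessor and is
   accessible at once. *)
pose R x y := [/\ M x, M y & x < y].
have wfR : well_founded R.
  move=> x; apply: contrapT => Nx.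
  have Mx y : ~ Acc R y -> M y.
    by move=> Ny; apply: contrapT => NMy; apply: Ny; split=> z [_ /NMy].
  have [||y Ny ymin] := woM [set y | ~ Acc R y]; first by move=> y /Mx.
    by exists x.
  apply: Ny; split=> z [_ _ zy]; apply: contrapT => /ymin.
  by rewrite oag_leNgt zy.
(* The default 0 is the right value: for [x] in [M] and e > 0, [R (x - e) x] fails only if [x - e]
   is outside [M], where [w] vanishes. *)
pose F x (rec : forall y, R y x -> k) : k :=
  if `[< M x >] then b x + \sum_(e <- L)
    a e * (if pselect (R (x - e) x) is left r then rec _ r else 0)
  else 0.
pose w := Fix wfR (fun=> k) F.
have wE x : w x = F x (fun y _ => w y).
  rewrite /w Fix_eq// => y f g fg; rewrite /F; case: ifP => // _.
  congr (_ + _); apply: eq_bigr => e _; congr (_ * _).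
  by case: pselect => // r; exact: fg.
have w0 x : w x != 0 -> M x.
  by apply: contra_neqP => Mx; rewrite wE /F asboolF.
exists w => // x; rewrite {1}wE /F; case: asboolP => Mx.
  congr (_ + _); apply: eq_big_seq => e eL; congr (_ * _).
  case: pselect => // NR; apply/esym/eqP; apply: contrapT => /negP /w0 Me.
  by apply: NR; split=> //; rewrite oag_ltrBl// L0.
(* For [x] outside [M], no [x - e] lies in [M], by closure, so both sides are 0. *)
have -> : b x = 0 by apply/eqP; apply: contrapT => /negP /bM.
rewrite add0r big1_seq// => e /andP[_ eL].
suff -> : w (x - e) = 0 by rewrite mulr0.
apply/eqP; apply: contrapT => /negP /w0 Me.
by apply: Mx; rewrite -(subrK e x); exact: MD.
Qed.

(** A product as a finite sum, so that [g] can be a bare function such as [series_one] or a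
    difference of coefficient functions. *)
Definition conv L f g : G -> k := fun x => \sum_(h <- L) f h * g (x - h).

Definition supported L f := forall h, f h != 0 -> h \in L.

Lemma supported_notin L f h : supported L f -> h \notin L -> f h = 0.
Proof. by move=> Lf; apply: contraNeq => /Lf. Qed.

Lemma series_mul_conv L s p :
  uniq L -> supported L s -> series_mul s p =1 conv L s p.
Proof.
move=> uL Ls x; rewrite /series_mul (fsbigE L)//.
  by apply: eq_bigl => h; rewrite in_setT.
by move=> h _ /(supported_notin Ls) ->; rewrite mul0r.
Qed.

(** Associativity and commutativity in the one form used, q(pu) = p(qu), obtained by exchanging two
    finite sums. *)
Lemma convCA L L' f f' g : conv L f (conv L' f' g) =1 conv L' f' (conv L f g).
Proof.
move=> x; rewrite /conv; under eq_bigr do rewrite mulr_sumr.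
rewrite exchange_big/=; apply: eq_bigr => h' _; rewrite mulr_sumr.
by apply: eq_bigr => h _; rewrite mulrCA addrAC.
Qed.

Lemma eq_conv L f g g' : g =1 g' -> conv L f g =1 conv L f g'.
Proof. by move=> gg' x; apply: eq_bigr => h _; rewrite gg'. Qed.

Lemma conv_one L f : uniq L -> supported L f -> conv L f (@series_one k G) =1 f.
Proof.
move=> uL Lf x; rewrite /conv /series_one.
have [xL|xL] := boolP (x \in L); last first.
  rewrite (supported_notin Lf xL) big1_seq// => h /andP[_ hL].
  rewrite subr_eq0; have [xh|_] := eqVneq x h; last by rewrite mulr0.
  by rewrite xh hL in xL.
rewrite (bigD1_seq x)//= subrr eqxx mulr1 big1 ?addr0// => h hx.
by rewrite subr_eq0 eq_sym (negPf hx) mulr0.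
Qed.

Lemma conv_supp L f g x :
  conv L f g x != 0 -> exists2 h, h \in L & g (x - h) != 0.
Proof.
move=> nz; have /hasP[h hL hg] : has (fun h => g (x - h) != 0) L.
  apply: contra_neqT nz => /hasPn L0; rewrite /conv big1_seq// => h /andP[_ hL].
  by rewrite (eqP (negbNE (L0 _ hL))) mulr0.
by exists h.
Qed.

Lemma leading_term s : nonzero_series s ->
  exists2 a, s a != 0 & forall h, s h != 0 -> a <= h.
Proof.
have /wo_chainP wos := @coef_wo _ _ s.
by move=> [x sx]; apply: (wos [set h | s h != 0]) => //; exists x.
Qed.

Lemma in_group_ringP q : in_group_ring q ->
  exists2 L, uniq L & supported L q.
Proof.
move=> /finite_seqP[L qL]; exists (undup L); first exact: undup_uniq.
move=> h qh; rewrite mem_undup.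
have : [set` support q] h by [].
by rewrite qL.
Qed.

(** A nonzero term at [h] needs a <= h and b <= a + b - h, which forces h = a. *)
Lemma conv_leading L f g a b : uniq L -> supported L f -> f a != 0 ->
    (forall h, f h != 0 -> a <= h) -> (forall h, g h != 0 -> b <= h) ->
  conv L f g (a + b) = f a * g b.
Proof.
move=> uL Lf fa amin bmin; rewrite /conv (bigD1_seq a) ?Lf//=.
rewrite [a + b]addrC addrK big1 ?addr0// => h ha.
have [->|/amin ah] := eqVneq (f h) 0; first by rewrite mul0r.
have [->|/bmin bh] := eqVneq (g (b + a - h)) 0; first by rewrite mulr0.
suff : h <= a by rewrite oag_leNgt lt_neqAle eq_sym ha ah.
by rewrite -(oag_leD2r h) subrK addrC [b + a]addrC oag_leD2r in bh.
Qed.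

(** If g and g' differed, then at their least point of difference g - g' would have a leading term,
    and its product with that of [q] would be a nonzero coefficient of q(g - g'). *)
Lemma conv_inj L q g g' : uniq L -> supported L q -> nonzero_series q ->
    well_ordered [set x | g x != g' x] ->
  conv L q g =1 conv L q g' -> g =1 g'.
Proof.
move=> uL Lq /leading_term[a qa amin] wog eqg x; apply: contrapT => gx.
pose d y := g y - g' y.
have [||b db bmin] := wog [set x | g x != g' x] => //.
  by exists x; apply/eqP.
have dmin h : d h != 0 -> b <= h by rewrite subr_eq0 => /bmin.
have : conv L q d (a + b) = 0.
  rewrite /conv; under eq_bigr do rewrite mulrBr.
  by rewrite sumrB; apply/eqP; rewrite subr_eq0; apply/eqP/eqg.
rewrite (conv_leading uL Lq qa amin dmin); apply/eqP.
by rewrite mulf_neq0// subr_eq0.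
Qed.

Lemma group_ring_inverse q : in_group_ring q -> nonzero_series q ->
  exists u, series_mul q u =1 @series_one k G.
Proof.
move=> /in_group_ringP[L0 uL0 L0q] /leading_term[a qa amin].
(* [L0] may list points below [a] where [q] vanishes; dropping them makes every element of [E]
   positive. *)
pose L := [seq h <- L0 | q h != 0].
have uL : uniq L by rewrite filter_uniq.
have Lq : supported L q by move=> h qh; rewrite mem_filter qh L0q.
pose E := [seq h - a | h <- rem a L].
have E0 : {in E, forall e, 0 < e}.
  move=> e /mapP[h]; rewrite mem_rem_uniq// !inE => /andP[ha].
  rewrite mem_filter => /andP[/amin ah _] ->.
  by rewrite oag_subr_gt0 lt_neqAle eq_sym ha.
have woM := well_ordered_submonoid_gen E0.
(* These coefficients make [w] the inverse of t^(-a) q, whose constant term is [q a]. *)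
have [||w wM wE] := @linear_recursion _ E (fun e => - (q (e + a) / q a))
    (fun x => series_one k x / q a) woM E0.
- by move=> x e; exact: submonoid_genD.
- move=> x; rewrite /series_one; case: (eqVneq x 0) => [-> _|_].
    exact: submonoid_gen0.
  by rewrite mul0r eqxx.
have wou : wo_chain <=%R (support (fun x => w (x + a))).
  apply/wo_chainP; apply: (well_ordered_sub (well_ordered_translate (- a) woM)).
  by move=> x /wM; rewrite /= opprK.
(* The inverse of [q] is t^(-a) w. In the product, the term at [a] is [q a * w x], and the recursion
   for [w x] cancels all the other terms. *)
exists (PowerSeries wou) => x.
rewrite (series_mul_conv _ uL Lq) /conv/= (big_rem a) ?Lq//= subrK.
rewrite {1}wE big_map mulrDr mulrC divfK// mulr_sumr -addrA -big_split/=.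
rewrite big1 ?addr0// => h _.
by rewrite subrK opprB addrA addrAC mulNr mulrN mulrA mulrCA divff// mulr1 addNr.
Qed.

Lemma supported_wo_chain L f : supported L f -> wo_chain <=%R (support f).
Proof.
move=> Lf; apply/wo_chainP.
by apply: (well_ordered_sub (@well_ordered_seq _ L)) => x; exact: Lf.
Qed.

Lemma supported_in_group_ring L p : supported L p -> in_group_ring p.
Proof. by move=> Lp; apply: sub_finite_set (finite_seq L) => x; exact: Lp. Qed.

End Series.

(** * Finite criteria for membership in k(G) *)

Lemma in_fraction_fieldP (k : fieldType) (G : oagType) (s : power_series k G) :
  in_fraction_field s <-> exists L (q : G -> k),
    [/\ uniq L, supported L q, exists x, q x != 0 & supported L (conv L q s)].
Proof.
split=> [[p [q [u [pf qf q0 qu spu]]]]|[L [q [uL Lq q0 Lqs]]]].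
  have [Lp uLp Lpp] := in_group_ringP pf.
  have [Lq uLq Lqq] := in_group_ringP qf.
  (* One list must contain both the exponents of [q] and the support of q s = p. *)
  pose L := undup (Lp ++ Lq); have uL : uniq L by exact: undup_uniq.
  have LLp : supported L p by move=> h /Lpp; rewrite mem_undup mem_cat => ->.
  have LLq : supported L q.
    by move=> h /Lqq; rewrite mem_undup mem_cat orbC => ->.
  exists L, q; split=> // h; suff -> : conv L q s h = p h by exact: LLp.
  (* q s = q(pu) = p(qu) = p. *)
  transitivity (conv L q (conv L p u) h).
    by apply: eq_conv => y; rewrite spu (series_mul_conv _ uL LLp).
  rewrite convCA -[RHS](conv_one uL LLp).
  by apply: eq_conv => y; rewrite -qu (series_mul_conv _ uL LLq).
pose qs := PowerSeries (supported_wo_chain Lq).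
pose ps := PowerSeries (supported_wo_chain Lqs).
have qsf : in_group_ring qs by exact: (@supported_in_group_ring _ _ L).
have psf : in_group_ring ps by exact: (@supported_in_group_ring _ _ L).
have [u qu] := group_ring_inverse qsf q0.
exists ps, qs, u; split=> // x; rewrite (@series_mul_conv _ _ L ps u)//.
(* It suffices to compare after multiplying by [q], since q(pu) = p = q s. The points where s and pu
   differ lie in the union of their supports, which is well-ordered. *)
apply: (conv_inj (q := qs) uL) x => //.
  have /wo_chainP wos := @coef_wo _ _ s; have /wo_chainP wou := @coef_wo _ _ u.
  apply: (well_ordered_sub
    (well_orderedU wos (well_ordered_translates L wou))) => x /= sx.
  have [s0|sn0] := eqVneq (s x) 0; last by left.
  by right; apply: (@conv_supp _ _ _ ps); rewrite -s0 eq_sym.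
move=> x; rewrite convCA -[LHS](conv_one uL Lqs).
by apply: eq_conv => y; rewrite -qu (@series_mul_conv _ _ L qs u).
Qed.

Theorem theorem4p7 (k : fieldType) (G : oagType) (s : power_series k G) :
  in_fraction_field s <->
  exists (l : nat) (g : 'I_l.+1 -> G) (r : 'I_l.+1 -> k),
    [/\ {homo g : i j / (i < j)%N >-> i < j},
        exists j, r j != 0
      & forall h : G, h \notin codom g -> \sum_(j < l.+1) r j * s (h - g j) = 0].
Proof.
rewrite in_fraction_fieldP; split=> [[L [q [uL Lq [x qx] Lqs]]]|].
  pose S := sort <=%R L.
  have memS : S =i L by exact: mem_sort.
  have S_sorted : sorted <%R S.
    by rewrite lt_sorted_uniq_le sort_uniq uL sort_sorted//; exact: oag_le_total.
  (* [q x] is nonzero, so [L] is nonempty and its size is a successor. *)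
  have [l sizeS] : exists l, size S = l.+1.
    by case: S memS {S_sorted} => [/(_ x)|y S' _]; [rewrite Lq|exists (size S')].
  exists l, (fun i => nth 0 S i), (fun i => q (nth 0 S i)); split.
  - move=> i j ij; apply: sorted_ltn_nth ij => //; first exact: lt_trans.
    + by rewrite inE sizeS.
    + by rewrite inE sizeS.
  - have xS : x \in S by rewrite memS Lq.
    have iS : (index x S < l.+1)%N by rewrite -sizeS index_mem.
    by exists (Ordinal iS); rewrite /= nth_index.
  - move=> h hS; have hL : h \notin L.
      apply: contra hS; rewrite -memS => hS; apply/codomP.
      have iS : (index h S < l.+1)%N by rewrite -sizeS index_mem.
      by exists (Ordinal iS); rewrite /= nth_index.
    rewrite -[RHS](supported_notin Lqs hL) /conv.
    rewrite [RHS](perm_big S) /=; last by rewrite perm_sym perm_sort.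
    by rewrite [RHS](big_nth 0) sizeS big_mkord.
move=> [l [g [r [g_mono [j rj] rs]]]].
have g_inj : injective g.
  move=> i i' gii'; apply/val_inj/eqP.
  by case: ltngtP => // /g_mono; rewrite gii' ltxx.
(* Summing over the fibre of [g] extends [r] by 0 off the image; by injectivity each fibre over the
   image is a single index. *)
pose q h := \sum_(j | g j == h) r j.
have qg i : q (g i) = r i.
  by rewrite /q (eq_bigl (pred1 i)) ?big_pred1_eq// => i'; rewrite /= inj_eq.
have convE h : conv (codom g) q s h = \sum_(i < l.+1) r i * s (h - g i).
  by rewrite /conv big_map big_enum/=; apply: eq_bigr => i _; rewrite qg.
exists (codom g), q; split.
- by rewrite map_inj_uniq ?enum_uniq.
- move=> h; apply: contraNT => hg; rewrite /q big1// => i /eqP gih.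
  by rewrite -gih codom_f in hg.
- by exists (g j); rewrite qg.
- by move=> h; apply: contraNT => /rs; rewrite -convE => ->.
Qed.
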